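(* For every $s>1$ there is a constant $C_s$, depending only on $s$, such that for every positive Borel measure $\mu$ on $\overline{T}$, $$\sup_{\alpha\in E}\frac{1}{\mu(S(\alpha))}\int_{S(\alpha)}\Big(\int_{S(\alpha)}d(x\wedge y)\,d\mu(x)\Big)^sd\mu(y)\le C_s\,[[\mu]]^s,$$ where $$[[\mu]]:=\sup_{\alpha\in E}\frac{1}{\mu(S(\alpha))}\sum_{\beta\subseteq\alpha}\mu(S(\beta))^2 .$$
   Context: Tree setting. $T$ is a simple connected graph without cycles, with finite or countable vertex set, in which every vertex has finitely many neighbours; $E$ is its set of edges. A root vertex $o$ is fixed, together with an auxiliary pre-root vertex $o^*$ which is joined to $o$ (by the root edge $\omega\in E$) and to no other vertex. $T$ also denotes the set of vertices other than $o^*$. For vertices $x,y$, $[x,y]$ is the set of edges of the unique geodesic joining them. $\partial T$ is the set of maximal geodesics starting at $o^*$; if $T$ is infinite all of these are assumed infinite, and if $T$ is finite a maximal geodesic is identified with the leaf at which it ends. For $x\in\partial T$, $[o^*,x]$ is the set of edges of the geodesic $x$. Put $\overline{T}=T\cup\partial T$ and, for $\alpha\in E$, $S(\alpha)=\{x\in\overline{T}:\alpha\in[o^*,x]\}$. $\overline{T}$ carries the (compact) topology generated by the sets $S(\alpha)$, $\alpha\in E$, and the singletons $\{x\}$, $x\in T$; positive Borel measures on $\overline{T}$ are finite. For an edge $\beta$, $e(\beta)$ is its endpoint farthest from $o^*$, and for edges $\beta\subseteq\alpha$ means $\alpha\in[o^*,e(\beta)]$. For $x,y\in\overline{T}$ the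 confluent $x\wedge y\in\overline{T}$ is defined by $[o^*,x\wedge y]=[o^*,x]\cap[o^*,y]$, and $d(x\wedge y)\in\mathbb{N}\cup\{\infty\}$ is the number of edges in $[o^*,x\wedge y]$. Conventions: $0\cdot\infty=0$ in integrals, and quotients are $0$ when $\mu(S(\alpha))=0$. The inequality is trivial if $[[\mu]]=\infty$. *)

(* Defs.v *)
From HB Require Import structures.
From mathcomp Require Import all_boot all_order all_algebra.
From mathcomp Require Import all_classical all_reals all_analysis.
Set Implicit Arguments.
Unset Strict Implicit.
Unset Printing Implicit Defensive.

Import Order.TTheory GRing.Theory Num.Theory.

Local Open Scope classical_set_scope.
Local Open Scope ring_scope.

(** As for [path], a walk is given by its first vertex [x] and the sequence [p]
    of the following ones; it is geodesic if it is a shortest walk between its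
    endpoints. *)
Definition geodesic (V : eqType) (adj : rel V) (x : V) (p : seq V) : Prop :=
  path adj x p /\
  forall q, path adj x q -> last x q = last x p -> (size p <= size q)%N.

(** The vertices include the pre-root.  Writing [T] for the tree, [T] as a set
    of vertices is [[set x | x != preroot]]. *)
Record rooted_tree := RootedTree {
  vertex :> countType;
  adj : rel vertex;
  preroot : vertex;
  rootv : vertex;
  adj_sym : symmetric adj;
  adj_irr : irreflexive adj;
  tree_connected : forall x y, exists2 p, path adj x p & last x p = y;
  tree_acyclic : forall c, ucycle adj c -> (size c <= 2)%N;
  tree_locally_finite : forall x, finite_set [set y | adj x y];
  adj_preroot : forall y, adj preroot y <-> y = rootv;
  (** in an infinite tree no finite geodesic from the pre-root is maximal *)
  tree_no_leaf : infinite_set [set: vertex] ->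
    forall p, geodesic adj preroot p ->
    exists y, geodesic adj preroot (rcons p y)
}.

Section tree.
Variable T : rooted_tree.

Lemma root_neq_preroot : rootv T != preroot T.
Proof.
apply/eqP => e; have /adj_preroot := erefl (rootv T).
by rewrite [X in adj _ X]e adj_irr.
Qed.

Definition edges : set (set T) :=
  [set a | exists x y, adj x y /\ a = [set x; y]].

Definition path_edges (x : T) (p : seq T) : set (set T) :=
  [set a | exists2 i, (i < size p)%N & a = [set nth x (x :: p) i; nth x p i]].

(** The geodesic exists and is unique in a tree: the default value is never
    used. *)
Definition geod (x y : T) : seq T :=
  xget [::] [set p | geodesic (@adj T) x p /\ last x p = y].

Definition geod_edges (x y : T) : set (set T) := path_edges x (geod x y).

Definition dist (x y : T) : nat := size (geod x y).

Definition far_end (b : set T) : T :=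
  xget (preroot T)
    [set v | b v /\ forall u, b u -> (dist (preroot T) u <= dist (preroot T) v)%N].

(** [subedge b a] is the relation "b is included in a" between edges. *)
Definition subedge (b a : set T) : Prop :=
  geod_edges (preroot T) (far_end b) a.

Definition infinite_geodesic (f : nat -> T) : Prop :=
  f 0%N = preroot T /\
  forall n, geodesic (@adj T) (preroot T) (mkseq (fun i => f i.+1) n).

(** The compactification of [T].  If [T] is infinite, its boundary consists of
    the infinite geodesics from the pre-root, as no finite one is maximal.  If
    [T] is finite there is no infinite geodesic, and the points of the boundary,
    being identified with leaves, are already vertices. *)
Variant Tbar : Type :=
| Vertex (x : T) of x != preroot T
| End (f : nat -> T) of infinite_geodesic f.

HB.instance Definition _ := gen_eqMixin Tbar.
HB.instance Definition _ := gen_choiceMixin Tbar.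
HB.instance Definition _ := isPointed.Build Tbar (Vertex root_neq_preroot).

Definition edges_to (x : Tbar) : set (set T) :=
  match x with
  | Vertex v _ => geod_edges (preroot T) v
  | End f _ => [set [set f n; f n.+1] | n in [set: nat]]
  end.

Definition Sset (a : set T) : set Tbar := [set x | edges_to x a].

Definition Tbar_subbase : set (set Tbar) :=
  [set Sset a | a in edges] `|`
  [set A | exists (v : T) (hv : v != preroot T), A = [set Vertex hv]].

HB.instance Definition _ :=
  isSubBaseTopological.Build Tbar Tbar_subbase id.

(** The confluent exists and is unique: the default value is never used. *)
Definition confluent (x y : Tbar) : Tbar :=
  xget point [set z | edges_to z = edges_to x `&` edges_to y].

(** [depth (confluent x y)] is "d(x /\ y)", with value [+oo] iff [x = y] is an
    infinite geodesic. *)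
Definition depth {R : realType} (x : Tbar) : \bar R := counting (edges_to x).

End tree.

Notation Tbar_borel T := (g_sigma_algebraType (@open (Tbar T))).

Section energy.
Context {R : realType} {T : rooted_tree}.
Local Open Scope ereal_scope.
Variable mu : {finite_measure set (Tbar_borel T) -> \bar R}.

(** [quot a x] is [x / mu (Sset a)], with value [0] if [mu (Sset a) = 0], since
    [0^-1 = 0] in [R] and [0 * +oo = 0] in [\bar R]. *)
Definition quot (a : set T) (x : \bar R) : \bar R :=
  ((fine (mu (Sset a)))^-1)%:E * x.

Definition energy_norm : \bar R :=
  ereal_sup [set quot a (\esum_(b in [set b | edges b /\ subedge b a])
                            (mu (Sset b)) ^+ 2)
            | a in @edges T].

End energy.

(* Main.v *)
Require Import Defs.
From HB Require Import structures.
From mathcomp Require Import all_boot all_order all_algebra.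
From mathcomp Require Import all_classical all_reals all_analysis.
From mathcomp Require Import finmap measurable_realfun lra ring.

(** Fix an edge [a], write [M b] for the mass of [Sset b], [K] for the energy
    norm, [nu b] for the mass of [Sset b `&` Sset a] and, for an edge or a
    point [y], [P y] for the sum of [nu b] over the edges [b] leading to [y].
    As the depth of a confluent counts common edges, the inner integral is at
    most [P y], and everything reduces to bounding the integral of [P `^ s]
    over [Sset a] by a multiple of [K `^ s * M a].

    Since [t `^ s <= 1 + t ^+ k.+1] when [s <= k.+1], an integer power
    suffices. The edges leading to [y] form a chain, and expanding a power of a
    sum along a chain according to the deepest of its indices gives, up to a
    factor [2 ^+ k], the bound [P y ^+ k.+1 <= \sum_b nu b * P b ^+ k], over
    the edges [b] leading to [y] ([esum_chain_pow]). Integrating in [y] turns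
    the right-hand side into the energy [\sum_b nu b ^+ 2 * P b ^+ k] over all
    edges. Applying the same expansion to [P b ^+ k] and exchanging sums lets
    the hypothesis [\sum_(b below c) nu b ^+ 2 <= L * nu c] absorb the square,
    which lowers the exponent [k] by one at the price of a factor [L]
    ([carleson_energyS]). After [k] rounds only [\sum_b nu b ^+ 2 <= L * M a]
    remains.

    The hypothesis is known for [M] with constant [K]; passing from [M] to its
    localisation [nu] at [a] adds the contribution of the edges above [a], that
    is [M a] squared times the depth of [a]. So one must know that the depth of
    [a] times [M a] is [O(K)] ([depth_mass]): a deep edge has small mass.

    On the combinatorial side all that is used of the tree is that the edges
    leading to a point form a chain, each initial segment of which consists of
    the edges that contain its last one in the sense of [subedge]; this rests
    on the uniqueness of geodesics ([geodesic_unique]). *)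

Set Implicit Arguments.
Unset Strict Implicit.
Unset Printing Implicit Defensive.

Import Order.TTheory GRing.Theory Num.Theory.

Local Open Scope classical_set_scope.
Local Open Scope ring_scope.
Local Open Scope ereal_scope.

(** * Nonnegative sums over arbitrary index sets *)

Section esum_extra.
Context {R : realType}.
Implicit Types I J : choiceType.

Lemma subset_esum I (A B : set I) (a : I -> \bar R) :
  A `<=` B -> \esum_(i in A) a i <= \esum_(i in B) a i.
Proof.
move=> AB; apply: ereal_sup_le => _ [X [finX XA] <-]; exists X => //.
by split => //; exact: subset_trans AB.
Qed.

Lemma esum_ge1 I (A : set I) (a : I -> \bar R) i :
  A i -> a i <= \esum_(j in A) a j.
Proof.
move=> Ai; apply: esum_ge; exists [set i]; last by rewrite fsbig_set1.
by split; [exact: finite_set1|move=> _ ->].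
Qed.

(** The case [c = +oo] is included; there both sides are [0] or [+oo] according
    to whether [a] vanishes on [A]. *)
Lemma esumZl I (A : set I) (c : \bar R) (a : I -> \bar R) : 0 <= c ->
  (forall i, 0 <= a i) -> \esum_(i in A) (c * a i) = c * \esum_(i in A) a i.
Proof.
have le_Z (x : \bar R) b : 0 <= x -> (forall i, 0 <= b i) ->
    \esum_(i in A) (x * b i) <= x * \esum_(i in A) b i.
  move=> x0 b0; apply: ge_ereal_sup => _ [X [finX XA] <-].
  rewrite -ge0_mule_fsumr//.
  by rewrite lee_wpmul2l// ereal_sup_ubound//; exists X.
move=> c0 a0; apply/eqP; rewrite eq_le le_Z//=.
have Zge0 i : 0 <= c * a i by exact: mule_ge0.
case: c c0 Zge0 => [r| |//] r0 Zge0.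
- have [->|rn0] := eqVneq r 0%R.
    by rewrite mul0e; apply: esum_ge0 => i Ai; rewrite mul0e.
  rewrite muleC -lee_pdivlMr ?lt0r ?rn0//.
  rewrite [leRHS]muleC; apply: le_trans (le_Z _ _ _ Zge0); last first.
    by rewrite lee_fin invr_ge0.
  by apply: le_esum => i Ai; rewrite muleA -EFinM mulVf// mul1e.
- have [[i [Ai ai]]|no] := pselect (exists i, A i /\ a i != 0).
    have := esum_ge1 (fun j => +oo * a j) Ai.
    by rewrite gt0_mulye ?lt0e ?ai ?a0//; apply: le_trans (leey _).
  rewrite (@esum1 _ _ A a) ?mule0 ?esum_ge0// => i Ai.
  by apply/eqP/negP => /negP ai; apply: no; exists i.
Qed.

Lemma exchange_esum I J (A : set I) (B : set J) (r : I -> set J)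
    (a : I -> J -> \bar R) : (forall i j, A i -> B j -> r i j -> 0 <= a i j) ->
  \esum_(i in A) \esum_(j in B `&` r i) a i j =
  \esum_(j in B) \esum_(i in A `&` [set i | r i j]) a i j.
Proof.
move=> a0; rewrite esum_esum; last by move=> i j Ai [Bj rij]; exact: a0.
rewrite esum_esum; last by move=> j i Bj [Ai rij]; exact: a0.
rewrite (reindex_esum (B `*`` (fun j => A `&` [set i | r i j])) _
  (fun x => (x.2, x.1)))//; split => /=.
- by move=> [j i] [/= Bj [Ai rij]].
- by move=> [j i] [j' i'] /= _ _ [-> ->].
- by move=> [i j] /= [Ai [Bj rij]]; exists (j, i).
Qed.

Lemma lee_expe (x y : \bar R) k : 0 <= x -> x <= y -> x ^+ k <= y ^+ k.
Proof.
move=> x0 xy; elim: k => [//|k IH].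
by rewrite !expeS lee_pmul// expe_ge0.
Qed.

Lemma esum_fin_num I (A : set I) (a : I -> \bar R) :
  finite_set A -> (forall i, A i -> 0 <= a i) ->
  (forall i, A i -> a i \is a fin_num) -> \esum_(i in A) a i \is a fin_num.
Proof.
move=> finA a0 afin; rewrite -[X in esum X]set_mem_set esum_fset ?set_mem_set//.
  rewrite fsbig_finite//; apply/sum_fin_numP => i.
  by rewrite in_fset_set// => /set_mem/afin.
by move=> i /set_mem /a0.
Qed.

Lemma counting_le_esum I (A : set I) :
  counting A <= \esum_(b in A) 1 :> \bar R.
Proof.
have card_le (F : {fset I}) : [set` F] `<=` A ->
    (#|` F|%:R)%:E <= \esum_(b in A) 1 :> \bar R.
  move=> FA; apply: esum_ge; exists [set` F]; first by split.
  rewrite fsbig_finite// set_fsetK -EFin_sum_fine//=.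
  by rewrite big_const_seq count_predT iter_addr_0.
rewrite /counting; case: asboolP => [finA|/infinite_set_fset infA].
  by apply: card_le; rewrite fset_setK.
rewrite leye_eq; apply/eqP/eq_infty => t.
have [F FA tF] := infA (Num.bound `|t|); apply: le_trans (card_le F FA).
rewrite lee_fin; apply: (@le_trans _ _ (Num.bound `|t|)%:R%R); last first.
  by rewrite ler_nat.
by apply: le_trans (ler_norm t) _; rewrite ltW// archi_boundP.
Qed.

(** * Powers of a sum along a chain *)

(** [up b c] reads: [c] lies above [b], that is, nearer to the root. *)
Section chain.
Variables (I : choiceType) (A : set I) (up : I -> set I).
Hypothesis total_up : forall b c, A b -> A c -> up b c \/ up c b.
Hypothesis trans_up : forall b c d, up b c -> up c d -> up b d.
Variable w : I -> \bar R.
Hypothesis w0 : forall b, 0 <= w b.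

Let W b := \esum_(c in A `&` up b) w c.

(** In the double sum on the left, of two indices one is above the other. If
    [c] is above [b], summing over [c] produces one more factor [W b]; if [b]
    is above [c], then [W b <= W c], and summing over [b] produces that factor
    too. *)
Lemma esum_chain_mul k :
  (\esum_(b in A) w b) * (\esum_(b in A) w b * W b ^+ k) <=
  2%:E * \esum_(b in A) w b * W b ^+ k.+1.
Proof.
have W0 b : 0 <= W b by exact: esum_ge0.
have wW0 b j : 0 <= w b * W b ^+ j by rewrite mule_ge0// expe_ge0.
set Y := \esum_(b in A) w b * W b ^+ k.+1.
rewrite muleC -esumZl//; last by exact: esum_ge0.
rewrite (_ : 2%:E = 1 + 1)// ge0_muleDl// ?mul1e.
have -> : \esum_(c in A) ((\esum_(b in A) w b * W b ^+ k) * w c) =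
  \esum_(c in A) \esum_(b in A) (w b * W b ^+ k * w c).
  apply: eq_esum => c Ac; rewrite muleC -esumZl//.
  by apply: eq_esum => b _; rewrite muleC.
have Ysum : Y = \esum_(b in A) \esum_(c in A `&` up b) (w b * W b ^+ k * w c).
  apply: eq_esum => b Ab; rewrite esumZl// expeS.
  by rewrite -muleA [W b * _]muleC.
apply: (@le_trans _ _ (\esum_(c in A)
   (\esum_(b in A `&` [set b | up b c]) (w b * W b ^+ k * w c) +
    \esum_(b in A `&` up c) (w b * W b ^+ k * w c)))).
  apply: le_esum => c Ac.
  rewrite (esumID [set b | up b c])//; last by move=> b _; rewrite mule_ge0.
  apply: leeD => //; apply: subset_esum => b [Ab nbc]; split => //.
  by case: (total_up Ab Ac).
rewrite esumD; first last.
- by move=> c Ac; apply: esum_ge0 => b _; rewrite mule_ge0.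
- by move=> c Ac; apply: esum_ge0 => b _; rewrite mule_ge0.
apply: leeD.
  by rewrite Ysum exchange_esum// => *; rewrite mule_ge0.
rewrite Ysum; apply: le_esum => c Ac; apply: le_esum => b [Ab cb].
rewrite muleAC [leRHS]muleAC [w c * w b]muleC.
rewrite lee_wpmul2l ?mule_ge0// lee_expe//.
by apply: subset_esum => d [Ad bd]; split => //; exact: trans_up bd.
Qed.

(** Were the chain a sequence and [W] its partial sums, this would be the
    discrete form of [W ^+ k.+1 = k.+1 * \int W ^+ k dW], with a worse
    constant. It holds for infinite chains and infinite sums alike. *)
Lemma esum_chain_pow k :
  (\esum_(b in A) w b) ^+ k.+1 <=
  (2 ^+ k)%:E * \esum_(b in A) w b * W b ^+ k.
Proof.
have W0 b : 0 <= W b by exact: esum_ge0.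
elim: k => [|k IH].
  by rewrite mul1e expeS expe0 mule1; apply: le_esum => b _; rewrite mule1.
rewrite expeS; apply: (@le_trans _ _ ((\esum_(b in A) w b) *
    ((2 ^+ k)%:E * \esum_(b in A) w b * W b ^+ k))).
  by rewrite lee_wpmul2l// esum_ge0.
rewrite muleCA exprSr EFinM -muleA lee_wpmul2l// ?lee_fin ?exprn_ge0//.
exact: esum_chain_mul.
Qed.

End chain.
End esum_extra.

(** * The Carleson condition on a forest *)

Section forest.
Context {R : realType} (I : choiceType) (E : set I) (up : I -> set I).
Hypothesis up_sub : forall b, up b `<=` E.
Hypothesis up_trans : forall b c d, up b c -> up c d -> up b d.
Hypothesis up_total : forall b c d, up b c -> up b d -> up c d \/ up d c.

Implicit Types M : I -> \bar R.

(** Here the sums over [up b] do not depend on the chain [A], which makes the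
    right-hand side integrable term by term when [A] varies. *)
Lemma esum_up_pow M (A : set I) k : (forall b, 0 <= M b) ->
  (forall b c, A b -> A c -> up b c \/ up c b) ->
  (\esum_(b in A) M b) ^+ k.+1 <=
  (2 ^+ k)%:E * \esum_(b in A) M b * (\esum_(c in up b) M c) ^+ k.
Proof.
move=> M0 totA; apply: le_trans (esum_chain_pow totA up_trans M0 k) _.
rewrite lee_wpmul2l// ?lee_fin ?exprn_ge0//; apply: le_esum => b Ab.
rewrite lee_wpmul2l// lee_expe ?esum_ge0//; apply: subset_esum.
exact: subIsetr.
Qed.

(** The energy condition, freed of quotients. *)
Definition carleson M (K : R) :=
  forall c, E c -> \esum_(b in E `&` [set b | up b c]) M b ^+ 2 <= K%:E * M c.

Section carleson_energy.
Variables (M : I -> \bar R) (K : R).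
Hypotheses (M0 : forall b, 0 <= M b) (K0 : (0 <= K)%R) (cM : carleson M K).

Let P b := \esum_(c in up b) M c.
Let B k := \esum_(b in E) M b ^+ 2 * P b ^+ k.

(** One factor of [P b ^+ k.+1 <= 2 ^+ k * \sum_c M c * P c ^+ k], with [c]
    above [b], is traded as follows: after exchanging sums, the inner sum of
    [M b ^+ 2] over the [b] below [c] is at most [K * M c] by the Carleson
    condition. *)
Lemma carleson_energyS k : B k.+1 <= (2 ^+ k * K)%:E * B k.
Proof.
have P0 b : 0 <= P b by exact: esum_ge0.
have MP0 c : 0 <= M c * P c ^+ k by rewrite mule_ge0// expe_ge0.
have MMP0 b c : 0 <= M b ^+ 2 * (M c * P c ^+ k).
  by rewrite mule_ge0// expe_ge0.
apply: (@le_trans _ _ (\esum_(b in E) (2 ^+ k)%:E *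
    \esum_(c in E `&` up b) M b ^+ 2 * (M c * P c ^+ k))).
  apply: le_esum => b Eb; rewrite setIidr//.
  rewrite esumZl ?expe_ge0// muleCA lee_wpmul2l ?expe_ge0//.
  by apply: esum_up_pow => // c d; exact: up_total.
rewrite esumZl ?lee_fin ?exprn_ge0//; last by move=> b; exact: esum_ge0.
rewrite EFinM -muleA lee_wpmul2l ?lee_fin ?exprn_ge0//.
rewrite exchange_esum// /B; rewrite -[leRHS]esumZl//; last first.
  by move=> b; rewrite mule_ge0 ?expe_ge0.
apply: le_esum => c Ec.
rewrite (eq_esum (b := fun b => (M c * P c ^+ k) * M b ^+ 2)); last first.
  by move=> b _; rewrite muleC.
rewrite esumZl//; last by move=> b; rewrite expe_ge0.
apply: (@le_trans _ _ ((M c * P c ^+ k) * (K%:E * M c))).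
  by rewrite lee_wpmul2l//; exact: cM.
by rewrite muleCA muleAC -expe2.
Qed.

Lemma carleson_energy k : B k <= (2 ^+ (k * k) * K ^+ k)%:E * B 0.
Proof.
have B0 : 0 <= B 0.
  by apply: esum_ge0 => b _; rewrite mule_ge0 ?expe_ge0 ?esum_ge0.
elim: k => [|k IH]; first by rewrite mulr1 mul1e.
apply: le_trans (carleson_energyS k) _.
apply: (@le_trans _ _ ((2 ^+ k * K)%:E * ((2 ^+ (k * k) * K ^+ k)%:E * B 0))).
  by rewrite lee_wpmul2l ?lee_fin ?mulr_ge0 ?exprn_ge0.
rewrite muleA -EFinM lee_wpmul2r// lee_fin mulrACA -exprD -exprS.
by rewrite ler_wpM2r ?exprn_ge0// ler_eXn2l ?ltr1n// mulSn mulnS leq_addl.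
Qed.

End carleson_energy.

Section depth_mass.
Variables (M : I -> \bar R) (K : R) (a : I).
Hypotheses (M0 : forall b, 0 <= M b) (Mfin : forall b, M b \is a fin_num).
Hypotheses (K0 : (0 <= K)%R) (cM : carleson M K).
Hypotheses (fin_up : finite_set (up a)) (Ma : forall b, up a b -> M a <= M b).

(** Let [d b] be the depth of [b]. The Carleson condition at each [c] above
    [a], weighted by [d c] and summed, gives
    [\sum_b (d b * M b) ^+ 2 <= 2 * K * \sum_b d b * M b], because the weights
    accumulated at [b] are at least [d b ^+ 2 / 2]. Hence the mean square of
    [d b * M b] over the [d a] edges above [a] is [O(K ^+ 2)], whereas
    [M b >= M a] makes it at least [(d a * M a) ^+ 2 / 4]. Weights are needed:
    with constant ones the same argument loses a logarithm of [d a]. *)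
Lemma depth_mass : (\esum_(c in up a) 1) * M a <= (4 * K)%:E.
Proof.
pose d b : \bar R := \esum_(c in up b) 1.
have d0 b : 0 <= d b by exact: esum_ge0.
have dMX2 b x : (d b * x) ^+ 2 = x ^+ 2 * d b ^+ 2.
  by rewrite !expe2 muleACA muleC.
pose Z := \esum_(b in up a) (d b * M b) ^+ 2.
have dfin b : up a b -> d b \is a fin_num.
  move=> ab; apply: esum_fin_num => //; apply: sub_finite_set fin_up => c.
  exact: up_trans.
have Zfin : Z \is a fin_num.
  apply: esum_fin_num => // b ab; first by rewrite expe_ge0 ?mule_ge0.
  by rewrite fin_numX// fin_numM// dfin.
have dM0 b : 0 <= d b * M b by rewrite mule_ge0.
(* [d] is a sum of unit masses along a chain, so that [esum_up_pow] bounds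
   [d b ^+ 2] by twice the sum of the [d c] with [c] above [b]. *)
have Z1 : Z <= (2 * K)%:E * \esum_(c in up a) d c * M c.
  apply: (@le_trans _ _ (\esum_(b in up a) 2%:E *
      \esum_(c in up a `&` up b) M b ^+ 2 * d c)).
    apply: le_esum => b ab; rewrite setIidr; last by move=> c; exact: up_trans.
    rewrite esumZl ?expe_ge0// muleCA dMX2.
    rewrite lee_wpmul2l ?expe_ge0//.
    have := @esum_up_pow (fun _ => 1) (up b) 1 (fun _ => lee01)
       (fun c e => @up_total b c e).
    rewrite expr1; congr (_ <= _ * _).
    by apply: eq_esum => c _; rewrite mul1e.
  rewrite esumZl//; last first.
    by move=> b; apply: esum_ge0 => c _; rewrite mule_ge0 ?expe_ge0.
  rewrite EFinM -muleA lee_wpmul2l// exchange_esum; last first.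
    by move=> b c _ _ _; rewrite mule_ge0 ?expe_ge0.
  rewrite -[leRHS]esumZl//; apply: le_esum => c ac.
  rewrite (eq_esum (b := fun b => d c * M b ^+ 2)); last first.
    by move=> b _; rewrite muleC.
  rewrite esumZl//; last by move=> b; rewrite expe_ge0.
  rewrite muleCA lee_wpmul2l//; apply: le_trans (cM (up_sub ac)).
  by apply: subset_esum; apply: setSI; exact: up_sub.
have Z2 : Z <= (4 * K ^+ 2)%:E * d a.
  rewrite -(leeD2lE _ _ Zfin).
  (* termwise, [2 * (2 * K) * t <= t ^+ 2 + 4 * K ^+ 2] with [t := d c * M c] *)
  apply: (@le_trans _ _ (\esum_(b in up a) (d b * M b) ^+ 2 +
      (4 * K ^+ 2)%:E * \esum_(c in up a) 1)); last by [].
    rewrite -[X in _ <= _ + X]esumZl ?lee_fin ?mulr_ge0 ?exprn_ge0//.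
    rewrite -[leRHS]esumD//; first last.
    - by move=> c _; rewrite mule1 lee_fin mulr_ge0 ?exprn_ge0.
    - by move=> c _; rewrite expe_ge0.
    apply: le_trans (leeD Z1 Z1) _; rewrite -esumZl ?lee_fin ?mulr_ge0//.
    rewrite -esumD; first last.
    - by move=> c _; rewrite mule_ge0 ?lee_fin ?mulr_ge0.
    - by move=> c _; rewrite mule_ge0 ?lee_fin ?mulr_ge0.
    apply: le_esum => c ac; rewrite mule1.
    have : d c * M c \is a fin_num by rewrite fin_numM ?dfin.
    case: (d c * M c) => // t _.
    rewrite -EFinM -EFin_expe -!EFinD lee_fin.
    by have := sqr_ge0 (t - 2 * K)%R; nra.
have Z3 : M a ^+ 2 * d a ^+ 3 <= 4%:E * Z.
  apply: (@le_trans _ _ (4%:E * \esum_(b in up a) (M a ^+ 2 * d b ^+ 2))).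
    rewrite esumZl ?expe_ge0//; last by move=> b; rewrite expe_ge0.
    rewrite [leRHS]muleCA lee_wpmul2l ?expe_ge0//.
    have := @esum_up_pow (fun _ => 1) (up a) 2 (fun _ => lee01)
       (fun c e => @up_total a c e).
    rewrite (_ : 2 ^+ 2 = 4 :> R)%R; last by ring.
    congr (_ <= _ * _).
    by apply: eq_esum => c _; rewrite mul1e.
  rewrite lee_wpmul2l//; apply: le_esum => b ab; rewrite -dMX2.
  by rewrite lee_expe ?mule_ge0// lee_wpmul2l// Ma.
have := le_trans Z3 (lee_wpmul2l (ltW (lte0n 4)) Z2).
rewrite -[\esum_(c in up a) 1]/(d a).
have : d a \is a fin_num by exact: esum_fin_num.
have : 0 <= d a by [].
have := M0 a; have := Mfin a.
case: (M a) => // m _; case: (d a) => // r; rewrite !lee_fin => m0 r0 _.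
rewrite ?lee_fin => H.
have [->|rn0] := eqVneq r 0%R; first by rewrite mul0r mulr_ge0.
have r_gt0 : (0 < r)%R by rewrite lt0r rn0.
rewrite -(@ler_pXn2r _ 2) ?nnegrE ?mulr_ge0// -(ler_pM2l r_gt0).
by move: H; congr (_ <= _)%R; ring.
Qed.
End depth_mass.

Section localize.
Variables (M : I -> \bar R) (K : R) (a : I).
Hypotheses (M0 : forall b, 0 <= M b) (Mfin : forall b, M b \is a fin_num).
Hypotheses (K0 : (0 <= K)%R) (cM : carleson M K).
Hypotheses (Ea : E a) (fin_up : finite_set (up a)).
Hypothesis Mle : forall b c, up b c -> M b <= M c.

(** The mass of the part of [Sset b] inside [Sset a], when [M] is the mass of
    [Sset] ([mass_localize]). *)
Definition localize b : \bar R :=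
  if `[< up b a >] then M b else if `[< up a b >] then M a else 0.

Lemma localize_ge0 b : 0 <= localize b.
Proof. by rewrite /localize; do 2 case: ifPn => // _. Qed.

Lemma localize_le b : localize b <= M b.
Proof.
by rewrite /localize; do 2 case: asboolP => //; move=> ab _; exact: Mle.
Qed.

Lemma localize_mono b c : up b c -> localize b <= localize c.
Proof.
move=> bc; rewrite {1}/localize; case: asboolP => [ba|nba].
  have [ca|ac] := up_total bc ba; rewrite /localize.
    by rewrite (asboolT ca); exact: Mle.
  by case: asboolP => _; rewrite ?(asboolT ac); exact: Mle.
case: asboolP => [ab|nab]; last exact: localize_ge0.
have ac := up_trans ab bc; rewrite /localize (asboolT ac).
by case: asboolP => // ca; exact: Mle.
Qed.

(** The edges below [a] contribute at most [K * M a], those above [a] the depth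
    of [a] times [M a ^+ 2], whence [5 = 1 + 4]. *)
Lemma localize_total :
  \esum_(b in E) localize b ^+ 2 <= (5 * K)%:E * M a.
Proof.
rewrite (esumID [set b | up b a]); last first.
  by move=> b _; rewrite expe_ge0 ?localize_ge0.
rewrite (_ : 5 * K = K + 4 * K)%R; last by ring.
rewrite EFinD ge0_muleDl ?lee_fin ?mulr_ge0//; apply: leeD.
  apply: le_trans (cM Ea); apply: le_esum => b _.
  by rewrite lee_expe ?localize_ge0 ?localize_le.
apply: (@le_trans _ _ (\esum_(b in up a) (M a ^+ 2 * 1))); last first.
  rewrite esumZl ?expe_ge0// expe2 -muleA muleC lee_wpmul2r// muleC.
  by apply: depth_mass => // b; exact: Mle.
rewrite esum_mkcond [leRHS]esum_mkcond; apply: le_esum => b _.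
have [/set_mem[Eb nba]|] := boolP (b \in _); last first.
  by case: ifPn => // _ _; rewrite mule1 expe_ge0.
rewrite /localize asboolF//; case: asboolP => [ab|nab].
  by rewrite mem_set// mule1.
by rewrite expe2 mul0e; case: ifP => // _; rewrite mule1 expe_ge0.
Qed.

(** At an edge [c] below [a] the condition is inherited from [M]; at an edge
    above [a] the right-hand side is [5 * K * M a], which bounds the sum over
    all edges; elsewhere both sides vanish. *)
Lemma carleson_localize : carleson localize (5 * K).
Proof.
move=> c Ec; have [cz|cn] := eqVneq (localize c) 0.
  rewrite cz mule0 esum1// => b [_ bc].
  have le0 : localize b <= 0 by rewrite -cz; exact: localize_mono.
  suff -> : localize b = 0 by rewrite expe2 mul0e.
  by apply/eqP; rewrite eq_le le0 localize_ge0.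
have [ca|nca] := pselect (up c a).
  rewrite [X in _ * X]/localize (asboolT ca).
  apply: (@le_trans _ _ (K%:E * M c)); last first.
    by rewrite lee_wpmul2r// lee_fin ler_peMl// ler1n.
  apply: le_trans (cM Ec); apply: le_esum => b _.
  by rewrite lee_expe ?localize_ge0 ?localize_le.
have ac : up a c.
  by apply: contrapT => nac; move: cn; rewrite /localize !asboolF ?eqxx.
rewrite [X in _ * X]/localize (asboolF nca) (asboolT ac).
apply: le_trans localize_total; apply: subset_esum; exact: subIsetl.
Qed.

Lemma localized_energy k :
  \esum_(b in E) localize b ^+ 2 * (\esum_(c in up b) localize c) ^+ k <=
  (2 ^+ (k * k) * (5 * K) ^+ k.+1)%:E * M a.
Proof.
have L0 : (0 <= 5 * K)%R by rewrite mulr_ge0.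
apply: le_trans (carleson_energy localize_ge0 L0 carleson_localize k) _.
rewrite exprSr mulrA [in leRHS]EFinM -[leRHS]muleA lee_wpmul2l//.
  by rewrite lee_fin mulr_ge0 ?exprn_ge0.
by apply: le_trans localize_total; apply: le_esum => b _; rewrite mule1.
Qed.

End localize.
End forest.

(** * Geodesics of a tree *)

Section geodesics.
Variable T : rooted_tree.
Implicit Types (x y z : T) (p q : seq T).
Local Notation geodesic := (geodesic (@adj T)).

Lemma geodesic_catl x p q : geodesic x (p ++ q) -> geodesic x p.
Proof.
case; rewrite cat_path => /andP[xp pq] min_p; split=> // r xr lr.
have := min_p (r ++ q); rewrite cat_path xr lr pq !last_cat lr !size_cat.
by rewrite leq_add2r; apply.
Qed.

Lemma geodesic_behead x y p : geodesic x (y :: p) -> geodesic y p.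
Proof.
case=> /= /andP[xy yp] min_p; split=> // q yq lq.
by apply: (min_p (y :: q)) => //=; rewrite xy.
Qed.

Lemma geodesic_uniq x p : geodesic x p -> uniq (x :: p).
Proof.
elim: p x => [//|y p IH] x gxyp.
rewrite [uniq _]/= -/(uniq (y :: p)) (IH _ (geodesic_behead gxyp)) andbT.
apply/negP; case: gxyp => + + xyp; case/splitPr: xyp => p1 p2.
rewrite cat_path /= => /and3P[_ _ xp2] /(_ p2 xp2).
by rewrite last_cat /= size_cat /= => /(_ erefl); rewrite addnS ltnNge leq_addl.
Qed.

Lemma geodesic_size x p q : geodesic x p -> geodesic x q ->
  last x p = last x q -> size p = size q.
Proof.
move=> [xp minp] [xq minq] e; apply/eqP; rewrite eqn_leq.
by rewrite (minp q)// (minq p).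
Qed.

(** Two distinct geodesics with the same endpoints, of minimal length, share
    only these endpoints: at another common vertex they would be cut into
    shorter pairs of geodesics, which coincide. Following one of them and then
    the other backwards gives a cycle of length more than [2]. *)
Lemma geodesic_unique x p q : geodesic x p -> geodesic x q ->
  last x p = last x q -> p = q.
Proof.
move: {2}(size p).+1 (ltnSn (size p)) => n.
elim: n x p q => [//|n IH] x p q; rewrite ltnS => szp gp gq e.
have szpq := geodesic_size gp gq e.
(* The first steps differ: the initial parts up to a common vertex before the
   end would be two geodesics excluded by induction. *)
have common P Q z : geodesic x P -> geodesic x Q -> (size P <= n)%N ->
    ohead P != ohead Q -> z \in P -> z \in Q -> z = last x P.
  move=> + + + + zP zQ; case/splitPr: zP => p1 p2; case/splitPr: zQ => q1 q2.
  move=> gP gQ szP nPQ; case/lastP: p2 => [|p2 v] in gP szP nPQ *.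
    by rewrite last_cat.
  suff pq : rcons p1 z = rcons q1 z.
    move: nPQ; have := congr1 ohead pq.
    by case: (p1) (q1) => [|? ?] [|? ?] /= /eqP h /negP.
  apply: (IH x); rewrite ?last_rcons//.
  - rewrite size_rcons; move: szP; rewrite size_cat /= size_rcons.
    by apply: leq_trans; rewrite !addnS !ltnS leq_addr.
  - by apply: geodesic_catl; rewrite cat_rcons; exact: gP.
  - by apply: geodesic_catl; rewrite cat_rcons; exact: gQ.
case: p q => [|a p] [|b q]// in gp gq e szp szpq *.
have [ab|nab] := eqVneq a b.
  rewrite -{b}ab in gq e szpq *; congr (_ :: _); apply: (IH a) => //.
  - exact: geodesic_behead gp.
  - exact: geodesic_behead gq.
have := common _ _ _ gp gq szp nab.
case/lastP eq : (b :: q) => [//|q0 v]; rewrite {}eq in gq e szpq * => {}common.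
have ev : last x (a :: p) = v by rewrite e last_rcons.
have gq_uniq := geodesic_uniq gq; have gp_uniq := geodesic_uniq gp.
suff /tree_acyclic : ucycle (@adj T) (x :: (a :: p) ++ rev q0).
  rewrite /= !ltnS size_cat size_rev leqn0 addn_eq0.
  move=> /andP[/nilP p0 /nilP q00].
  by rewrite p0 q00 /= in ev *; rewrite ev.
have closes : path (@adj T) x ((a :: p) ++ rcons (rev q0) x).
  rewrite cat_path gp.1 ev -rev_cons -[x :: q0](belast_rcons x q0 v).
  rewrite -[v in path _ v](last_rcons x q0 v) rev_path.
  by rewrite (eq_path (e' := @adj T)) ?gq.1// => y z; exact: adj_sym.
rewrite /ucycle -cat_cons cat_uniq gp_uniq rev_uniq; apply/andP; split.
  by rewrite cat_cons /= rcons_cat.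
move: gq_uniq; rewrite /= rcons_uniq mem_rcons inE negb_or => /and3P[].
move=> /andP[xv xq0] vq0 ->; rewrite andbT; apply/hasPn => z.
rewrite mem_rev => zq0; rewrite inE negb_or; apply/andP; split.
  by apply: contraNN xq0 => /eqP <-.
apply/negP => zp; have zv : z = v.
  by rewrite -ev; apply: common => //; rewrite mem_rcons inE zq0 orbT.
by rewrite -zv zq0 in vq0.
Qed.

Lemma geodesic_exists x y : exists p, geodesic x p /\ last x p = y.
Proof.
pose P n := `[< exists p, [/\ path (@adj T) x p, last x p = y & size p = n] >].
have exP : exists n, P n.
  have [p xp lp] := tree_connected x y.
  by exists (size p); apply/asboolP; exists p.
case: (ex_minnP exP) => n /asboolP[p [xp lp sp]] minP.
exists p; split=> //; split=> // q xq lq.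
by rewrite sp; apply: minP; apply/asboolP; exists q; split=> //; rewrite lq.
Qed.

Lemma geodP x y : geodesic x (geod x y) /\ last x (geod x y) = y.
Proof.
exact: (@xgetPex _ [::] [set p | geodesic x p /\ last x p = y]
  (geodesic_exists x y)).
Qed.

Lemma geod_last x p : geodesic x p -> geod x (last x p) = p.
Proof.
by move=> gp; have [g l] := geodP x (last x p); exact: geodesic_unique g gp l.
Qed.

Lemma dist_last x p : geodesic x p -> dist x (last x p) = size p.
Proof. by move=> gp; rewrite /dist geod_last. Qed.

End geodesics.

(** * The order on edges *)

Section rays.
Variable T : rooted_tree.
Local Notation geodesic := (geodesic (@adj T)).
Local Notation o := (preroot T).
Implicit Types (f : nat -> T) (D : set nat) (A : set (set T)) (a b c d : set T).

(** A finite or infinite geodesic from the pre-root, as a function [f] relevant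
    on the initial segment [D] of its edge numbers: treating vertices and ends
    of the tree alike avoids doing everything twice. *)
Definition ray f D :=
  [/\ f 0%N = o, forall i j, D j -> (i <= j)%N -> D i &
      forall i, D i -> geodesic o (mkseq (f \o S) i.+1)].

Definition ray_edge f i : set T := [set f i; f i.+1].

Definition ray_edges f D : set (set T) := ray_edge f @` D.

Lemma geod_ray (v : T) : exists f D, [/\ ray f D, geod_edges o v = ray_edges f D
  & D = [set i | (i < dist o v)%N]].
Proof.
have [gp lp] := geodP o v; set p := geod o v in gp lp.
pose f := nth o (o :: p); pose D := [set i | (i < size p)%N].
exists f, D; split=> //; last first.
  rewrite /geod_edges /path_edges -/p; apply/seteqP; split=> e.
    by case=> i ip ->; exists i.
  by case=> i ip <-; exists i.
split=> // [i j|i /= ip]; first by move=> + ij; exact: leq_ltn_trans.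
apply: (@geodesic_catl T o _ (drop i.+1 p)).
rewrite (_ : mkseq (f \o S) i.+1 = take i.+1 p) ?cat_take_drop//.
apply: (@eq_from_nth _ o); first by rewrite size_mkseq size_takel.
by move=> j; rewrite size_mkseq => ji; rewrite nth_mkseq// nth_take.
Qed.

Lemma end_ray f (hf : infinite_geodesic f) : ray f setT.
Proof. by case: hf => f0 g; split=> // i _; exact: g. Qed.

Lemma edges_to_ray (y : Tbar T) :
  exists f D, [/\ ray f D, edges_to y = ray_edges f D & D 0%N].
Proof.
case: y => [v vo|f hf]; last by exists f, setT; split=> //; exact: end_ray.
have [f [D [rD eD DE]]] := geod_ray v; exists f, D; split=> //.
rewrite DE /= lt0n; apply/eqP => d0; move/eqP: vo; apply.
have [_ <-] := geodP o v; move: d0; rewrite /dist.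
by case: (geod o v).
Qed.

Section ray_theory.
Variables (f : nat -> T) (D : set nat).
Hypothesis fD : ray f D.

Lemma last_ray i : last o (mkseq (f \o S) i.+1) = f i.+1.
Proof.
by rewrite (last_nth o) size_mkseq -[LHS]/(nth o _ i) nth_mkseq.
Qed.

Lemma geod_rayS i : D i -> geod o (f i.+1) = mkseq (f \o S) i.+1.
Proof.
by case: fD => _ _ g Di; rewrite -last_ray; apply: geod_last; exact: g.
Qed.

Lemma dist_rayS i : D i -> dist o (f i.+1) = i.+1.
Proof. by move=> Di; rewrite /dist geod_rayS// size_mkseq. Qed.

Lemma dist_ray i : D i -> dist o (f i) = i.
Proof.
case: fD => f0 closD _; case: i => [_|i Di].
  have g0 : geodesic o [::] by split.
  by rewrite f0; exact: (dist_last g0).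
by apply: dist_rayS; exact: closD Di _.
Qed.

Lemma far_end_ray i : D i -> far_end (ray_edge f i) = f i.+1.
Proof.
move=> Di; apply: xget_subset1 => /=.
  split; first by right.
  by move=> u [|] ->; rewrite dist_rayS// ?dist_ray.
move=> u v [uE umax] [vE vmax].
have top w : ray_edge f i w ->
    (forall u, ray_edge f i u -> (dist o u <= dist o w)%N) -> w = f i.+1.
  move=> [->|->//] /(_ (f i.+1)); rewrite dist_rayS// dist_ray// ltnn.
  by move=> h; have : false by apply: h; right.
by rewrite (top u)// (top v).
Qed.

(** The geodesic to the far end of an edge of a ray is an initial segment of
    that ray, by uniqueness: this makes [subedge] behave as an order. *)
Lemma subedge_ray i : D i ->
  subedge (ray_edge f i) = ray_edges f [set j | (j <= i)%N].
Proof.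
move=> Di; apply/funext => a; rewrite /subedge far_end_ray//.
rewrite /geod_edges /path_edges geod_rayS//; case: fD => f0 _ _.
have nthf j : (j <= i)%N ->
    [set nth o (o :: mkseq (f \o S) i.+1) j; nth o (mkseq (f \o S) i.+1) j] =
    ray_edge f j.
  move=> ji; rewrite nth_mkseq//=; case: j ji => [_|j ji] /=.
    by rewrite -f0.
  by rewrite nth_mkseq// ltnW.
rewrite propeqE; split.
  by move=> [j]; rewrite size_mkseq ltnS => ji ->; exists j => //; rewrite nthf.
by move=> [j ji <-]; exists j; [rewrite size_mkseq ltnS|rewrite nthf].
Qed.

Lemma ray_adj i : D i -> adj (f i) (f i.+1).
Proof.
move=> Di; case: fD => f0 _ g; have [pf _] := g _ Di.
have /(pathP o)/(_ i) := pf.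
rewrite size_mkseq ltnSn => /(_ isT); rewrite nth_mkseq//.
by case: i {Di pf} => [|i] /=; rewrite ?f0// nth_mkseq// ltnW.
Qed.

End ray_theory.

Definition lineage A := exists f D, ray f D /\ A = ray_edges f D.

Lemma lineage_edges A : lineage A -> A `<=` @edges T.
Proof.
move=> [f [D [fD ->]]] _ [i Di <-]; exists (f i), (f i.+1); split=> //.
exact: ray_adj fD _ Di.
Qed.

Lemma lineage_refl A b : lineage A -> A b -> subedge b b.
Proof.
move=> [f [D [fD ->]]] [i Di <-]; rewrite (subedge_ray fD Di).
by exists i => /=.
Qed.

Lemma lineage_up A b : lineage A -> A b -> subedge b `<=` A.
Proof.
move=> [f [D [fD ->]]] [i Di <-]; rewrite (subedge_ray fD Di).
move=> _ [j /= ji <-]; exists j => //.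
by case: fD => _ + _; apply; [exact: Di|].
Qed.

Lemma lineage_total A b c : lineage A -> A b -> A c ->
  subedge b c \/ subedge c b.
Proof.
move=> [f [D [fD ->]]] [i Di <-] [j Dj <-].
rewrite (subedge_ray fD Di) (subedge_ray fD Dj).
by have [ij|/ltnW ji] := leqP j i; [left; exists j|right; exists i].
Qed.

Lemma lineage_subedge b : lineage (subedge b).
Proof. by have [f [D [fD e _]]] := geod_ray (far_end b); exists f, D. Qed.

Lemma lineage_edges_to (y : Tbar T) : lineage (edges_to y).
Proof. by have [f [D [fD e _]]] := edges_to_ray y; exists f, D. Qed.

Lemma finite_subedge b : finite_set (subedge b).
Proof.
have [f [D [_ e DE]]] := geod_ray (far_end b).
rewrite -[subedge b]/(geod_edges o (far_end b)) e DE.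
exact/finite_image/finite_II.
Qed.

Lemma subedge_trans b c d : subedge b c -> subedge c d -> subedge b d.
Proof. by move=> bc; apply: lineage_up bc d; exact: lineage_subedge. Qed.

Lemma subedge_total b c d : subedge b c -> subedge b d ->
  subedge c d \/ subedge d c.
Proof. exact/lineage_total/lineage_subedge. Qed.

Lemma subedge_sub b : subedge b `<=` @edges T.
Proof. exact/lineage_edges/lineage_subedge. Qed.

Lemma countable_edges : countable (@edges T).
Proof.
have : countable ((fun u : T * T => [set u.1; u.2]) @` setT).
  by apply: card_le_trans (card_image_le _ _) _; exact: countableP.
apply: sub_countable; apply: subset_card_le => _ [x [y [_ ->]]].
by exists (x, y).
Qed.

Lemma Sset_subedge b c : subedge b c -> Sset b `<=` Sset c.
Proof.
by move=> bc y yb; exact: (lineage_up (lineage_edges_to y) yb).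
Qed.

Definition root_edge : set T := [set o; rootv T].

Lemma root_edge_edges_to (y : Tbar T) : edges_to y root_edge.
Proof.
have [f [D [fD -> D0]]] := edges_to_ray y; exists 0%N => //.
have := ray_adj fD D0; rewrite /ray_edge; case: fD => -> _ _.
by move/adj_preroot => ->.
Qed.

Lemma edges_to_root : edges_to (point : Tbar T) = [set root_edge].
Proof.
have gr : geodesic o [:: rootv T].
  split; first by rewrite /= andbT; exact/adj_preroot.
  move=> [|? ?]//= _ e.
  by have := root_neq_preroot T; rewrite -e eqxx.
rewrite /= /geod_edges (geod_last gr) /path_edges; apply/seteqP; split=> a.
  by move=> [[|//] _ ->].
by move=> ->; exists 0%N.
Qed.

(** An inclusion is enough to bound the depth from above. It covers the default
    value of [confluent] too, since the only edge leading to the root leads to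
    every point. *)
Lemma edges_to_confluent (x y : Tbar T) :
  edges_to (confluent x y) `<=` edges_to x `&` edges_to y.
Proof.
rewrite /confluent; case: xgetP => [z _ /= ->//|_].
rewrite edges_to_root => _ ->; split; exact: root_edge_edges_to.
Qed.

End rays.

(** * Integration *)

Section integration.
Context d (X : measurableType d) (R : realType).
Variable mu : {measure set X -> \bar R}.

(** The integral of a nonnegative function is a supremum over the simple
    functions below it, hence monotone also at functions, such as an inner
    integral, whose measurability is not established. *)
Lemma ge0_le_integral_lower (D : set X) (f g : X -> \bar R) :
  (forall x, D x -> 0 <= f x) -> (forall x, D x -> f x <= g x) ->
  \int[mu]_(x in D) f x <= \int[mu]_(x in D) g x.
Proof.
move=> f0 fg; have g0 x : D x -> 0 <= g x.
  by move=> Dx; exact: le_trans (f0 _ Dx) (fg _ Dx).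
rewrite !ge0_integralE//; apply: ereal_sup_le => _ [h /= hf <-].
by exists h => //= x; apply: le_trans (hf x) _; exact: lee_restrict.
Qed.

Variables (I : pointedType) (E : set I) (S : I -> set X) (w : I -> \bar R).
Hypotheses (cE : countable E) (mS : forall b, E b -> measurable (S b)).
Hypothesis (w0 : forall b, 0 <= w b).

Let enum_esum : exists (P : set nat) (e : nat -> I),
  (forall n, P n -> E (e n)) /\
  forall a : I -> \bar R, (forall b, 0 <= a b) ->
  \esum_(b in E) a b = \sum_(n <oo) (if n \in P then a (e n) else 0).
Proof.
have [P] := countable_bijP _ cE; rewrite card_eq_sym => /card_set_bijP[e eP].
exists P, e; split; first by case: eP => eP _ _ n Pn; exact: eP.
move=> a a0; rewrite (reindex_esum P E e)// esum_mkcond nneseries_esumT//.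
by move=> n; case: ifP.
Qed.

Let esum_mem x : \esum_(b in E `&` [set b | S b x]) w b =
  \esum_(b in E) w b * (\1_(S b) x)%:E.
Proof.
rewrite esum_mkcondr; apply: eq_esum => b _; rewrite indicE.
have [Sb|nSb] := pselect (S b x).
  by rewrite (mem_set (A := [set b | S b x]) Sb) (mem_set Sb) mule1.
by rewrite (memNset (A := [set b | S b x]) nSb) (memNset nSb) mule0.
Qed.

Let wS0 x b : 0 <= w b * (\1_(S b) x)%:E.
Proof. by rewrite mule_ge0// lee_fin. Qed.

Let mwS b D : E b -> measurable_fun D (fun x => w b * (\1_(S b) x)%:E).
Proof.
move=> Eb; apply: emeasurable_funM => //; apply/measurable_EFinP.
exact: measurable_indic (mS Eb).
Qed.

Lemma measurable_esum_mem D :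
  measurable_fun D (fun x => \esum_(b in E `&` [set b | S b x]) w b).
Proof.
have [P [e [PE eE]]] := enum_esum.
under eq_fun do rewrite esum_mem eE//.
rewrite (_ : (fun x => _) = (fun x => \sum_(n <oo | n \in predT)
    if n \in P then w (e n) * (\1_(S (e n)) x)%:E else 0))//.
apply: ge0_emeasurable_sum => [n x _ _|n _]; first by case: ifP.
by have [/set_mem/PE|_] := boolP (n \in P); [exact: mwS|exact: measurable_cst].
Qed.

(** Tonelli for the kernel [1_(S b) x]: with [S := Sset] it integrates a sum
    over the edges leading to [x]. *)
Lemma integral_esum_mem D : measurable D ->
  \int[mu]_(x in D) (\esum_(b in E `&` [set b | S b x]) w b) =
  \esum_(b in E) w b * mu (S b `&` D).
Proof.
move=> mD; have [P [e [PE eE]]] := enum_esum.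
under eq_integral do rewrite esum_mem eE//.
rewrite integral_nneseries//; first last.
- by move=> n x Dx; case: ifP.
- move=> n; have [/set_mem/PE|_] := boolP (n \in P); first exact: mwS.
  exact: measurable_cst.
rewrite eE; last by move=> b; rewrite mule_ge0.
apply: eq_eseriesr => n _.
have [/set_mem/PE Een|_] := boolP (n \in P); last exact: integral0.
rewrite ge0_integralZl//.
- by rewrite integral_indic//; exact: mS.
- by apply/measurable_EFinP; exact: measurable_indic (mS Een).
Qed.

End integration.

(** [u `^ s <= 1 + u ^+ k.+1] for [u := x / L], distinguishing [u <= 1]. *)
Lemma poweR_le_expe (R : realType) (s L : R) (x : \bar R) (k : nat) :
  (0 < L)%R -> (1 < s)%R -> (s <= k.+1%:R)%R -> 0 <= x ->
  x `^ s <= (L `^ s)%:E + (L `^ s / L ^+ k.+1)%:E * x ^+ k.+1.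
Proof.
move=> L0 s1 sk.
have s0 : (0 < s)%R by apply: lt_trans s1.
case: x => [t||//] x0; last first.
  rewrite poweRyr ?gt_eqF// (_ : +oo ^+ k.+1 = +oo :> \bar R).
    by rewrite gt0_muley ?addey// lte_fin divr_gt0 ?powR_gt0 ?exprn_gt0.
  by elim: (k) => // j IH; rewrite expeS IH mulyy.
rewrite lee_fin in x0.
rewrite poweR_EFin -EFin_expe -EFinM -EFinD lee_fin.
have -> : (t `^ s = L `^ s * (t / L) `^ s)%R.
  by rewrite -powRM ?divr_ge0 ?(ltW L0)// mulrC divfK ?gt_eqF.
rewrite -mulrA -[X in (_ <= X + _)%R]mulr1 -mulrDr ler_wpM2l ?powR_ge0//.
rewrite [((_ ^+ _)^-1 * _)%R]mulrC -expr_div_n.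
have u0 : (0 <= t / L)%R by rewrite divr_ge0// ltW.
have [u1|u1] := leP (t / L)%R 1%R.
  apply: (@le_trans _ _ 1%R); last by rewrite lerDl exprn_ge0.
  have := @ge0_ler_powR _ s (ltW s0) (t / L)%R 1%R.
  by rewrite powR1; apply; rewrite ?nnegrE.
apply: (@le_trans _ _ ((t / L) ^+ k.+1)%R); last by rewrite lerDr.
by rewrite -powR_mulrn//; apply: ler_powR => //; exact: ltW.
Qed.

(** * The energy inequality *)

Section main.
Context {R : realType} {T : rooted_tree}.
Variable mu : {finite_measure set (Tbar_borel T) -> \bar R}.
Implicit Types a b c : set T.

Let M b := mu (Sset b).

(** For [a] not an edge the set is empty. *)
Lemma measurable_Sset a : measurable (Sset a : set (Tbar_borel T)).
Proof.
have [Ea|nEa] := pselect (edges a); last first.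
  rewrite (_ : Sset a = set0); first exact: measurable0.
  apply/seteqP; split=> // y ya; apply: nEa.
  exact: lineage_edges (lineage_edges_to y) _ ya.
apply: sub_sigma_algebra; exists [set Sset a]; last by rewrite bigcup_set1.
move=> _ ->; exists [fset (Sset a : set (Tbar T))]%fset.
  by move=> B; rewrite inE => /eqP ->; apply: mem_set; left; exists a.
by rewrite /= set_fset1 bigcap_set1.
Qed.

Lemma mass_ge0 b : 0 <= M b. Proof. exact: measure_ge0. Qed.

Lemma mass_fin b : M b \is a fin_num.
Proof. by apply: fin_num_measure; exact: measurable_Sset. Qed.

Lemma mass_le b c : subedge b c -> M b <= M c.
Proof.
move=> bc; apply: le_measure; last exact: Sset_subedge.
- by apply: mem_set; exact: measurable_Sset.
- by apply: mem_set; exact: measurable_Sset.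
Qed.

Lemma carleson_energy_norm (K : R) : energy_norm mu = K%:E ->
  carleson (@edges T) (@subedge T) M K.
Proof.
move=> eK c Ec.
have [Mc0|Mcn] := eqVneq (M c) 0.
  rewrite Mc0 mule0 esum1// => b [_ bc].
  suff -> : M b = 0 by rewrite expe2 mul0e.
  by apply/eqP; rewrite eq_le mass_ge0 -Mc0 mass_le.
have : quot mu c (\esum_(b in [set b | edges b /\ subedge b c]) M b ^+ 2)
    <= K%:E by rewrite -eK; apply: ereal_sup_ubound; exists c.
have := mass_fin c; have := mass_ge0 c; move: Mcn.
rewrite /quot -/(M c); case: (M c) => // m mn0 m0 _.
have m_gt0 : (0 < m)%R by rewrite -lte_fin lt0e mn0 m0.
by rewrite muleC lee_pdivrMr.
Qed.

(** Keep only the term [b = a] of the sum. If [M a] is positive then [Sset a]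
    has a point, so that [a] is an edge of a geodesic from the pre-root and
    belongs to the sum. *)
Lemma energy_norm_ge a : edges a -> M a <= energy_norm mu.
Proof.
move=> Ea; apply: le_ereal_sup_tmp.
exists (quot mu a (\esum_(b in [set b | edges b /\ subedge b a]) M b ^+ 2)).
  by exists a.
have S0 : 0 <= \esum_(b in [set b | edges b /\ subedge b a]) M b ^+ 2.
  by apply: esum_ge0 => b _; rewrite expe_ge0// mass_ge0.
have [Ma0|Man0] := eqVneq (M a) 0.
  by rewrite Ma0 /quot -/(M a) Ma0 /= invr0 mul0e.
have [y ya] : Sset a !=set0.
  by apply/set0P; apply: contra_neq Man0 => S0'; rewrite /M S0' measure0.
have aa : subedge a a := lineage_refl (lineage_edges_to y) ya.
have := esum_ge1 (A := [set b | edges b /\ subedge b a]) (fun b => M b ^+ 2)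
  (conj Ea aa).
rewrite /= /quot -/(M a); have := mass_fin a; have := mass_ge0 a; move: Man0.
case: (M a) => // m mn0 m0 _.
have m_gt0 : (0 < m)%R by rewrite -lte_fin lt0e mn0 m0.
by rewrite [X in _ -> _ <= X]muleC lee_pdivlMr// expe2.
Qed.

Lemma mass_localize a b : edges b ->
  mu (Sset b `&` Sset a) = localize (@subedge T) M a b.
Proof.
move=> Eb; rewrite /localize; case: asboolP => [ba|nba].
  by rewrite setIidl//; exact: Sset_subedge.
case: asboolP => [ab|nab]; first by rewrite setIidr//; exact: Sset_subedge.
rewrite (_ : Sset b `&` Sset a = set0) ?measure0//.
apply/seteqP; split=> // y [yb ya].
by case: (lineage_total (lineage_edges_to y) ya yb).
Qed.

Lemma depth_ge0 (y : Tbar T) : 0 <= depth y :> \bar R.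
Proof. by rewrite /depth /counting; case: ifP => _; rewrite ?lee_fin ?leey. Qed.

(** The depth of [confluent x y] counts edges [b] leading to [y] with [x] in
    [Sset b], and each of them has mass [localize b] inside [Sset a]. *)
Lemma inner_integral_le a (y : Tbar T) :
  \int[mu]_(x in Sset a) depth (confluent x y) <=
  \esum_(b in edges_to y) localize (@subedge T) M a b.
Proof.
have Ey : edges_to y `<=` @edges T := lineage_edges (lineage_edges_to y).
apply: (@le_trans _ _ (\int[mu]_(x in Sset a)
    (\esum_(b in edges_to y `&` [set b | Sset b x]) 1))).
  apply: ge0_le_integral_lower => x _; first exact: depth_ge0.
  apply: le_trans (counting_le_esum _) _; apply: subset_esum => b.
  by move=> /edges_to_confluent[].
rewrite (@integral_esum_mem _ _ _ mu _ _ (@Sset T))//.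
- by apply: le_esum => b yb; rewrite mul1e -(mass_localize a (Ey _ yb)).
- by apply: sub_countable (@countable_edges T); exact: subset_card_le.
- by move=> b _; exact: measurable_Sset.
- exact: measurable_Sset.
Qed.

(** Pointwise, the inner integral to the power [s] is at most
    [L `^ s + L `^ s / L ^+ k.+1 * 2 ^+ k * G y], where [L := 5 * K] is the
    Carleson constant of the localised mass; [G] integrates to an energy. *)
Lemma outer_integral_le (s K : R) (k : nat) a : edges a ->
  (1 < s)%R -> (s <= k.+1%:R)%R -> (0 < K)%R -> energy_norm mu = K%:E ->
  \int[mu]_(y in Sset a) (\int[mu]_(x in Sset a) depth (confluent x y)) `^ s <=
  (((5 * K) `^ s) * (1 + 2 ^+ (k + k * k)))%:E * M a.
Proof.
move=> Ea s1 sk K0 eK; have cM := carleson_energy_norm eK.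
pose L : R := (5 * K)%R; have L0 : (0 < L)%R by rewrite mulr_gt0.
pose nu := localize (@subedge T) M a.
have nu0 b : 0 <= nu b by apply: localize_ge0; exact: mass_ge0.
pose P b := \esum_(c in subedge b) nu c.
have P0 b : 0 <= P b by exact: esum_ge0.
pose g b := nu b * P b ^+ k.
have g0 b : 0 <= g b by rewrite mule_ge0// expe_ge0.
pose G (y : Tbar T) := \esum_(b in @edges T `&` [set b | Sset b y]) g b.
have G0 y : 0 <= G y by exact: esum_ge0.
have mS b : measurable (Sset b : set (Tbar_borel T)) := measurable_Sset b.
have mG : measurable_fun (Sset a : set (Tbar_borel T)) G.
  exact: (measurable_esum_mem (@countable_edges T) (fun b _ => mS b) g0).
pose c1 : R := (L `^ s)%R; pose c2 : R := (L `^ s / L ^+ k.+1 * 2 ^+ k)%R.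
have c1_ge0 : (0 <= c1)%R by exact: powR_ge0.
have c2_ge0 : (0 <= c2)%R.
  by rewrite mulr_ge0 ?divr_ge0 ?powR_ge0 ?exprn_ge0// ltW.
apply: (@le_trans _ _ (\int[mu]_(y in Sset a) (c1%:E + c2%:E * G y))).
  apply: ge0_le_integral_lower => y _; first exact: poweR_ge0.
  have := inner_integral_le a y.
  set U := integral _ _ _; set V := esum _ _ => UV.
  have V0 : 0 <= V by exact: esum_ge0.
  have U0 : 0 <= U by apply: integral_ge0 => x _; exact: depth_ge0.
  apply: (@le_trans _ _ (V `^ s)).
    apply: gt0_ler_poweR => //; first by rewrite ltW// (lt_trans _ s1).
    - by rewrite in_itv/= U0 leey.
    - by rewrite in_itv/= V0 leey.
  apply: le_trans (poweR_le_expe L0 s1 sk V0) _; rewrite leeD2l//.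
  rewrite [c2%:E]EFinM -muleA lee_wpmul2l//.
    by rewrite lee_fin divr_ge0 ?powR_ge0 ?exprn_ge0// ltW.
  have totEy b c : edges_to y b -> edges_to y c -> subedge b c \/ subedge c b.
    exact: lineage_total (lineage_edges_to y).
  apply: le_trans (esum_up_pow (@subedge_trans T) k nu0 totEy) _.
  rewrite lee_wpmul2l// ?lee_fin ?exprn_ge0//; apply: subset_esum => b yb.
  by split => //; exact: lineage_edges (lineage_edges_to y) _ yb.
have Gint : \int[mu]_(y in Sset a) G y <=
    (2 ^+ (k * k) * L ^+ k.+1)%:E * M a.
  rewrite (integral_esum_mem mu (@countable_edges T) (fun b _ => mS b) g0)//.
  apply: le_trans (localized_energy (@subedge_sub T) (@subedge_trans T)
    (@subedge_total T) mass_ge0 mass_fin (ltW K0) cM Ea (@finite_subedge T a)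
    mass_le k).
  apply: le_esum => b Eb; rewrite [X in _ * X <= _](mass_localize a Eb).
  by rewrite /g muleAC -expe2.
rewrite (ge0_integralD mu (mS a) (f1 := fun=> c1%:E)); first last.
- by apply: emeasurable_funM => //; exact: measurable_cst.
- by move=> y _; rewrite mule_ge0.
- exact: measurable_cst.
- by move=> y _; rewrite lee_fin.
rewrite (integral_cst mu (mS a)) (ge0_integralZl mu (mS a) mG)//.
apply: le_trans (leeD (le_refl _) (lee_wpmul2l _ Gint)) _; first by [].
rewrite -[X in c1%:E * X]/(M a).
have := mass_fin a; case: (M a) => // m _.
rewrite -!EFinM -EFinD lee_fin -/L -/c1 mulrA.
rewrite (_ : c2 * _ = c1 * 2 ^+ (k + k * k))%R.
  by rewrite mulrDr mulr1 mulrDl.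
rewrite /c2 -/c1 exprD; field.
by rewrite expf_neq0// gt_eqF.
Qed.
End main.

Theorem theorem10 (R : realType) (s : R) (hs : (1 < s)%R) :
  exists2 C : R, (0 < C)%R &
    forall (T : rooted_tree) (mu : {finite_measure set (Tbar_borel T) -> \bar R}),
      ereal_sup
        [set quot mu a
           (\int[mu]_(y in Sset a)
              (\int[mu]_(x in Sset a) depth (confluent x y)) `^ s)
        | a in @edges T]
      <= C%:E * energy_norm mu `^ s.
Proof.
have s0 : (0 < s)%R by apply: lt_trans hs.
pose k := Num.bound s.
have sk : (s <= k.+1%:R)%R.
  by rewrite ltW// (lt_trans (archi_boundP (ltW s0)))// ltr_nat.
pose C : R := (5 `^ s * (1 + 2 ^+ (k + k * k)))%R.
have C0 : (0 < C)%R by rewrite mulr_gt0 ?powR_gt0 ?addr_gt0 ?exprn_gt0.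
exists C => // T mu; apply: ge_ereal_sup => _ [a Ea <-].
have Ma := energy_norm_ge mu Ea.
have RHS0 : 0 <= C%:E * energy_norm mu `^ s.
  by rewrite mule_ge0 ?poweR_ge0// lee_fin ltW.
have [m0|mn0] := eqVneq (mu (Sset a)) 0.
  by rewrite /quot m0 /= invr0 mul0e.
have m_gt0 : 0 < mu (Sset a) by rewrite lt0e mn0 measure_ge0.
case eK : (energy_norm mu) Ma RHS0 => [K| |] Ma RHS0.
- have K0 : (0 < K)%R by rewrite -lte_fin; exact: lt_le_trans Ma.
  have := outer_integral_le Ea hs sk K0 eK.
  rewrite /quot; have := mass_fin mu a; move: m_gt0.
  case: (mu (Sset a)) => // m; rewrite lte_fin => m_gt0 _.
  rewrite poweR_EFin -!EFinM /= [X in _ -> X <= _]muleC lee_pdivrMr//.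
  rewrite (_ : C * K `^ s = (5 * K) `^ s * (1 + 2 ^+ (k + k * k)))%R//.
  by rewrite powRM ?ltW// /C; ring.
- by rewrite poweRyr ?gt_eqF// gt0_muley ?leey// lte_fin.
- by move: Ma; rewrite leeNy_eq => /eqP e; rewrite e in mn0 m_gt0.
Qed.
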